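(* The map $i:\mathbb{N}^{\mathbb{N}}\to\Sigma^{\mathbb{N}\times\mathbb{N}}$, $i(\alpha)=\{(n,\alpha(n))\mid n\in\mathbb{N}\}$, is a weak intrinsic inclusion, but it is not an intrinsic inclusion.
   Context: We work constructively, in higher-order intuitionistic logic with Dependent Choice, together with three axioms. (i) Markov principle: if $\alpha\in2^{\mathbb{N}}$ is not identically zero, then $\alpha(n)=1$ for some $n$. (ii) Enumerability Axiom: there is a surjection $\mathbb{N}\to\Sigma^{\mathbb{N}}$. (iii) Stable Subspace Axiom: for every $\neg\neg$-stable $Z\subseteq\mathbb{N}$ the restriction $\Sigma^{\mathbb{N}}\to\Sigma^Z$ is surjective. $\Sigma=\{p\in\Omega\mid\exists f\in2^{\mathbb{N}}(p\Leftrightarrow\exists n\,f(n)=1)\}$. An injective map $i:X\to Y$ is an intrinsic inclusion if every $S:X\to\Sigma$ is of the form $S=T\circ i$ for some $T:Y\to\Sigma$. It is a weak intrinsic inclusion if every $S:X\to\Sigma$ extends along $i$ to a multivalued $\bar S:Y\rightrightarrows\Sigma$, i.e. $\bar S(i(x))=\{S(x)\}$ for all $x\in X$. A multivalued map is one valued in inhabited subsets. *)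

(* Defs.v *)
(* Omega = Prop.
   Equality on Omega (and hence on Sigma) is logical equivalence, and
   equality on function spaces is pointwise: we work with setoids so that
   no extensionality axiom is built into the statement. *)
From Stdlib Require Import Arith.

(** The Rosolini dominance Sigma, as a subset of Omega = Prop. *)
Record Sig : Type := mkSig {
  sprop : Prop;
  sprop_semidec : exists f : nat -> bool, sprop <-> exists n, f n = true
}.

Definition Sig_eq (p q : Sig) : Prop := sprop p <-> sprop q.

Definition baire_eq (a b : nat -> nat) : Prop := forall n, a n = b n.

Definition SigNN_eq (u v : nat * nat -> Sig) : Prop :=
  forall z, Sig_eq (u z) (v z).

Lemma eqnat_semidec (m k : nat) :
  exists f : nat -> bool, (m = k) <-> exists n, f n = true.
Proof.
  exists (fun _ => Nat.eqb m k). split.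
  - intros H. exists 0. now apply Nat.eqb_eq.
  - intros [_ H]. now apply Nat.eqb_eq.
Qed.

Definition Sig_of_eq (m k : nat) : Sig := mkSig (m = k) (eqnat_semidec m k).

Definition graph_map (alpha : nat -> nat) : nat * nat -> Sig :=
  fun z => Sig_of_eq (snd z) (alpha (fst z)).

(** Intrinsic inclusion, for maps between setoids (X, eqX), (Y, eqY).
    Maps X -> Sigma are the eqX-extensional ones. *)
Definition intrinsic_inclusion {X Y : Type}
    (eqX : X -> X -> Prop) (eqY : Y -> Y -> Prop) (i : X -> Y) : Prop :=
  (forall x x', eqY (i x) (i x') -> eqX x x') /\
  forall S : X -> Sig, (forall x x', eqX x x' -> Sig_eq (S x) (S x')) ->
    exists T : Y -> Sig,
      (forall y y', eqY y y' -> Sig_eq (T y) (T y')) /\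
      forall x, Sig_eq (S x) (T (i x)).

(** Weak intrinsic inclusion: every S extends along i to a multivalued map
    Sbar : Y => Sigma (a relation, extensional, with inhabited values) such
    that Sbar(i x) = {S x}. *)
Definition weak_intrinsic_inclusion {X Y : Type}
    (eqX : X -> X -> Prop) (eqY : Y -> Y -> Prop) (i : X -> Y) : Prop :=
  (forall x x', eqY (i x) (i x') -> eqX x x') /\
  forall S : X -> Sig, (forall x x', eqX x x' -> Sig_eq (S x) (S x')) ->
    exists Sbar : Y -> Sig -> Prop,
      (forall y y' s s', eqY y y' -> Sig_eq s s' -> Sbar y s -> Sbar y' s') /\
      (forall y, exists s, Sbar y s) /\
      forall x s, Sbar (i x) s <-> Sig_eq s (S x).

Definition DependentChoice : Prop :=
  forall (X : Type) (R : X -> X -> Prop),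
    (forall x, exists y, R x y) ->
    forall x0, exists f : nat -> X, f 0 = x0 /\ forall n, R (f n) (f (S n)).

Definition MarkovPrinciple : Prop :=
  forall alpha : nat -> bool,
    ~ (forall n, alpha n = false) -> exists n, alpha n = true.

Definition EnumerabilityAxiom : Prop :=
  exists e : nat -> (nat -> Sig),
    forall f : nat -> Sig, exists n, forall k, Sig_eq (e n k) (f k).

(** Elements of Sigma^Z are represented as functions on proofs of
    membership that do not depend on the membership proof. *)
Definition StableSubspaceAxiom : Prop :=
  forall Z : nat -> Prop, (forall n, ~ ~ Z n -> Z n) ->
    forall g : forall n, Z n -> Sig,
      (forall n (p q : Z n), Sig_eq (g n p) (g n q)) ->
      exists f : nat -> Sig, forall n (p : Z n), Sig_eq (f n) (g n p).

(* Main.v *)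
(* Weak intrinsic inclusion: the codes (under an enumeration of Sigma^(N x N)) of graphs of
   functions form a not-not-stable set of indices, by Markov's principle, and on it
   "the code denotes some i(a) with S a" is Sigma-valued.  The Stable Subspace Axiom
   extends this to all codes, and Sbar y collects the values at all codes of y.

   Not an intrinsic inclusion: a diagonal argument against the enumeration, together with
   Markov's principle, shows that every Sigma-valued map on Sigma^(N x N) is monotone
   and continuous, so T (i 0) forces T (i b) for all b vanishing below some N.  But
   S b := "at the first x with b x <> 0, b x is the value at x of one of the first x
   enumerated partial functions" is Sigma-valued (the graph of b has its own index,
   which settles all x beyond it) and holds at 0, while by pigeonhole it fails for
   one of the N + 1 functions that are 0 below N and take the values 1, ..., N + 1 at N. *)
Require Import Defs.
From Stdlib Require Import Arith Lia List Bool Cantor Permutation Wf_nat.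

Definition semidec (P : Prop) : Prop :=
  exists f : nat -> bool, P <-> exists n, f n = true.

Lemma semidec_iff (P Q : Prop) : (P <-> Q) -> semidec P -> semidec Q.
Proof. intros HPQ [f Hf]. exists f. tauto. Qed.

Lemma semidec_bool (b : bool) : semidec (b = true).
Proof.
  exists (fun _ => b). split.
  - intros Hb. now exists 0.
  - now intros [_ Hb].
Qed.

Lemma semidec_seq (f : nat -> bool) : semidec (exists n, f n = true).
Proof. exists f. reflexivity. Qed.

Lemma semidec_and (P Q : Prop) : semidec P -> semidec Q -> semidec (P /\ Q).
Proof.
  intros [f Hf] [g Hg].
  exists (fun n => f (fst (of_nat n)) && g (snd (of_nat n))). split.
  - intros [[a Ha]%Hf [b Hb]%Hg]. exists (to_nat (a, b)).
    rewrite cancel_of_to; cbn. now rewrite Ha, Hb.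
  - intros [n [H1 H2]%andb_prop]. split; [apply Hf | apply Hg]; eauto.
Qed.

Lemma semidec_or (P Q : Prop) : semidec P -> semidec Q -> semidec (P \/ Q).
Proof.
  intros [f Hf] [g Hg]. exists (fun n => f n || g n). split.
  - intros [[a Ha]%Hf | [a Ha]%Hg]; exists a; rewrite Ha; [easy | apply orb_true_r].
  - intros [n [H | H]%orb_true_iff]; [left; apply Hf | right; apply Hg]; eauto.
Qed.

Definition Sig_of_bool (b : bool) : Sig := mkSig (b = true) (semidec_bool b).

Definition Sig_of_seq (f : nat -> bool) : Sig := mkSig (exists n, f n = true) (semidec_seq f).

Definition Sig_and (s t : Sig) : Sig :=
  mkSig (sprop s /\ sprop t) (semidec_and _ _ (sprop_semidec s) (sprop_semidec t)).

Definition Sig_or (s t : Sig) : Sig :=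
  mkSig (sprop s \/ sprop t) (semidec_or _ _ (sprop_semidec s) (sprop_semidec t)).

Lemma SigNN_eq_sym (y y' : nat * nat -> Sig) : SigNN_eq y y' -> SigNN_eq y' y.
Proof. intros H z. specialize (H z). unfold Sig_eq in *. tauto. Qed.

Lemma SigNN_eq_trans (y y' y'' : nat * nat -> Sig) :
  SigNN_eq y y' -> SigNN_eq y' y'' -> SigNN_eq y y''.
Proof. intros H H' z. specialize (H z). specialize (H' z). unfold Sig_eq in *. tauto. Qed.

Lemma countable_choice (DC : DependentChoice) (A : Type) (P : nat -> A -> Prop) :
  (forall n, exists a, P n a) -> exists F : nat -> A, forall n, P n (F n).
Proof.
  intros HP. destruct (HP 0) as [a0 _].
  destruct (DC (nat * A)%type (fun u v => fst v = S (fst u) /\ P (fst u) (snd v)))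
    with (x0 := (0, a0)) as [f [f0 fS]].
  - intros [n a]. destruct (HP n) as [b Hb]. now exists (S n, b).
  - assert (f_index : forall n, fst (f n) = n).
    { induction n as [|n IH]; [now rewrite f0|]. now rewrite (proj1 (fS n)), IH. }
    exists (fun n => snd (f (S n))). intros n.
    rewrite <- (f_index n) at 1. apply fS.
Qed.

Lemma semidec_exists (DC : DependentChoice) (P : nat -> Prop) :
  (forall n, semidec (P n)) -> semidec (exists n, P n).
Proof.
  intros HP. destruct (countable_choice DC _ _ HP) as [F HF].
  exists (fun q => F (fst (of_nat q)) (snd (of_nat q))). split.
  - intros [n [k Hk]%HF]. exists (to_nat (n, k)). now rewrite cancel_of_to.
  - intros [q Hq]. exists (fst (of_nat q)). apply HF. eauto.
Qed.

Lemma semidec_stable (MP : MarkovPrinciple) (P : Prop) : semidec P -> ~ ~ P -> P.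
Proof.
  intros [f Hf] NNP. apply Hf, MP. intros Hnone.
  apply NNP. intros [n Hn]%Hf. congruence.
Qed.

Lemma Sig_exists_stable (DC : DependentChoice) (MP : MarkovPrinciple) (P : nat -> Sig) :
  ~ ~ (exists n, sprop (P n)) -> exists n, sprop (P n).
Proof.
  apply semidec_stable; [exact MP|]. apply semidec_exists; [exact DC|].
  intros n. apply sprop_semidec.
Qed.

Lemma semidecider_enumeration (DC : DependentChoice) (EA : EnumerabilityAxiom) :
  exists E : nat -> nat -> nat -> bool,
    forall P : nat -> Sig, exists j, forall n, sprop (P n) <-> exists k, E j n k = true.
Proof.
  destruct EA as [e He].
  destruct (countable_choice DC (nat -> bool)
              (fun q f => sprop (e (fst (of_nat q)) (snd (of_nat q))) <-> exists k, f k = true)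
              (fun q => sprop_semidec _)) as [F HF].
  exists (fun j n => F (to_nat (j, n))). intros P.
  destruct (He P) as [j Hj]. exists j. intros n.
  rewrite <- HF, cancel_of_to. symmetry. apply Hj.
Qed.

Lemma no_Sig_of_all_false (DC : DependentChoice) (EA : EnumerabilityAxiom)
    (h : (nat -> bool) -> Sig) :
  ~ (forall f, sprop (h f) <-> forall k, f k = false).
Proof.
  intros Hh. destruct (semidecider_enumeration DC EA) as [E HE].
  destruct (HE (fun n => h (E n n))) as [j Hj].
  specialize (Hj j). rewrite Hh in Hj.
  assert (Hnot : (forall k, E j j k = false) <-> ~ exists k, E j j k = true).
  { split.
    - intros Hall [k Hk]. congruence.
    - intros Hnone k. destruct (E j j k) eqn:Hk; [|easy]. exfalso; eauto. }
  tauto.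
Qed.

Definition none_below (f : nat -> bool) (n : nat) : bool := negb (existsb f (seq 0 n)).

Lemma none_below_spec (f : nat -> bool) (n : nat) :
  none_below f n = true <-> forall k, k < n -> f k = false.
Proof.
  unfold none_below. rewrite negb_true_iff. split.
  - intros Hn k Hk. destruct (f k) eqn:Hfk; [|easy].
    rewrite <- Hn. symmetry. apply existsb_exists. exists k. rewrite in_seq. split; [lia | easy].
  - intros Hall. apply not_true_iff_false. intros [k [Hk Hfk]]%existsb_exists.
    rewrite in_seq in Hk. rewrite Hall in Hfk by lia. discriminate.
Qed.

Section SigmaValuedMaps.

Variables (DC : DependentChoice) (MP : MarkovPrinciple) (EA : EnumerabilityAxiom).
Variables (A : Type) (T : (A -> Sig) -> Sig).
Hypothesis T_ext : forall y y', (forall a, Sig_eq (y a) (y' a)) -> Sig_eq (T y) (T y').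

(* If T y held but T y' failed, p |-> T (y \/ (y' /\ p)) would be a Sigma-valued negation. *)
Lemma Sig_map_monotone (y y' : A -> Sig) :
  (forall a, sprop (y a) -> sprop (y' a)) -> sprop (T y) -> sprop (T y').
Proof.
  intros Hyy' Ty. apply (semidec_stable MP); [apply sprop_semidec|]. intros NTy'.
  apply (no_Sig_of_all_false DC EA
           (fun f => T (fun a => Sig_or (y a) (Sig_and (y' a) (Sig_of_seq f))))).
  intros f. split.
  - intros Hf k. destruct (f k) eqn:Hfk; [|easy]. exfalso. apply NTy'.
    refine (proj1 (T_ext _ _ _) Hf). intros a. unfold Sig_eq; cbn. firstorder.
  - intros Hf. refine (proj2 (T_ext _ _ _) Ty). intros a. unfold Sig_eq; cbn.
    split; [|tauto]. intros [? | [_ [k Hk]]]; [easy | congruence].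
Qed.

Lemma Sig_map_continuous (level : A -> nat) (y : A -> Sig) :
  sprop (T y) ->
  exists N, sprop (T (fun a => Sig_and (y a) (Sig_of_bool (level a <? N)))).
Proof.
  intros Ty. apply (Sig_exists_stable DC MP). intros Hnone.
  apply (no_Sig_of_all_false DC EA
           (fun f => T (fun a => Sig_and (y a) (Sig_of_bool (none_below f (S (level a))))))).
  intros f. split.
  - intros Hf k. destruct (f k) eqn:Hfk; [|easy]. exfalso. apply Hnone. exists k.
    refine (Sig_map_monotone _ _ _ Hf). cbn. intros a [Hya Hlev]. split; [easy|].
    apply Nat.ltb_lt. destruct (Nat.lt_ge_cases (level a) k) as [Hlt | Hge]; [easy|].
    rewrite none_below_spec in Hlev. rewrite Hlev in Hfk by lia. discriminate.
  - intros Hf. refine (proj2 (T_ext _ _ _) Ty). intros a. unfold Sig_eq; cbn.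
    rewrite none_below_spec. firstorder.
Qed.

End SigmaValuedMaps.

Lemma pair_enumeration (EA : EnumerabilityAxiom) :
  exists e : nat -> nat * nat -> Sig, forall y, exists k, SigNN_eq (e k) y.
Proof.
  destruct EA as [e He]. exists (fun k z => e k (to_nat z)). intros y.
  destruct (He (fun q => y (of_nat q))) as [k Hk]. exists k. intros z.
  specialize (Hk (to_nat z)). now rewrite cancel_of_to in Hk.
Qed.

Section StableImage.

Variables (X : Type) (eqX : X -> X -> Prop) (i : X -> nat * nat -> Sig).
Hypothesis i_reflects : forall x x', SigNN_eq (i x) (i x') -> eqX x x'.
Variable S : X -> Sig.
Hypothesis S_ext : forall x x', eqX x x' -> Sig_eq (S x) (S x').

Definition image_value (y : nat * nat -> Sig) : Prop :=
  exists x, SigNN_eq y (i x) /\ sprop (S x).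

Lemma image_value_at (y : nat * nat -> Sig) (x : X) :
  SigNN_eq y (i x) -> (image_value y <-> sprop (S x)).
Proof.
  intros Hy. split.
  - intros [x' [Hx' Sx']]. refine (proj1 (S_ext x' x _) Sx').
    apply i_reflects. exact (SigNN_eq_trans _ _ _ (SigNN_eq_sym _ _ Hx') Hy).
  - intros Sx. now exists x.
Qed.

Lemma image_value_semidec (y : nat * nat -> Sig) :
  (exists x, SigNN_eq y (i x)) -> semidec (image_value y).
Proof.
  intros [x Hx]. apply (semidec_iff (sprop (S x))); [|apply sprop_semidec].
  symmetry. now apply image_value_at.
Qed.

End StableImage.

Lemma weak_intrinsic_inclusion_of_stable_image (EA : EnumerabilityAxiom)
    (SSA : StableSubspaceAxiom) (X : Type) (eqX : X -> X -> Prop)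
    (i : X -> nat * nat -> Sig) :
  (forall x x', SigNN_eq (i x) (i x') -> eqX x x') ->
  (forall y, ~ ~ (exists x, SigNN_eq y (i x)) -> exists x, SigNN_eq y (i x)) ->
  weak_intrinsic_inclusion eqX SigNN_eq i.
Proof.
  intros i_reflects image_stable. split; [exact i_reflects|]. intros S S_ext.
  destruct (pair_enumeration EA) as [e He].
  destruct (SSA (fun k => exists x, SigNN_eq (e k) (i x)) (fun k => image_stable (e k))
              (fun k p => mkSig _ (image_value_semidec X eqX i i_reflects S S_ext (e k) p)))
    as [f Hf].
  { intros k p q. unfold Sig_eq. reflexivity. }
  assert (f_at_image : forall k x, SigNN_eq (e k) (i x) -> Sig_eq (f k) (S x)).
  { intros k x Hk. specialize (Hf k (ex_intro _ x Hk)). unfold Sig_eq in *. cbn in Hf.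
    rewrite Hf. now apply (image_value_at X eqX i i_reflects S S_ext). }
  exists (fun y s => exists k, SigNN_eq (e k) y /\ Sig_eq s (f k)). split; [|split].
  - intros y y' s s' Hy Hs [k [Hk Hsk]]. exists k. split.
    + exact (SigNN_eq_trans _ _ _ Hk Hy).
    + unfold Sig_eq in *. tauto.
  - intros y. destruct (He y) as [k Hk]. exists (f k), k. split; [exact Hk | easy].
  - intros x s. split.
    + intros [k [Hk Hsk]]. specialize (f_at_image k x Hk). unfold Sig_eq in *. tauto.
    + intros Hs. destruct (He (i x)) as [k Hk]. exists k. split; [exact Hk|].
      specialize (f_at_image k x Hk). unfold Sig_eq in *. tauto.
Qed.

Lemma graph_map_injective (a b : nat -> nat) :
  SigNN_eq (graph_map a) (graph_map b) -> baire_eq a b.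
Proof. intros H n. now apply (H (n, a n)). Qed.

Definition is_graph (y : nat * nat -> Sig) : Prop :=
  forall n, (exists m, sprop (y (n, m))) /\
            (forall m m', sprop (y (n, m)) -> sprop (y (n, m')) -> m = m').

Lemma is_graph_stable (DC : DependentChoice) (MP : MarkovPrinciple) (y : nat * nat -> Sig) :
  ~ ~ is_graph y -> is_graph y.
Proof.
  intros NNy n. split.
  - apply (Sig_exists_stable DC MP (fun m => y (n, m))).
    intros Hnone. apply NNy. intros Hy. exact (Hnone (proj1 (Hy n))).
  - intros m m' Hm Hm'. destruct (Nat.eq_dec m m') as [| Hne]; [easy|].
    exfalso. apply NNy. intros Hy. exact (Hne (proj2 (Hy n) m m' Hm Hm')).
Qed.

Lemma is_graph_iff (DC : DependentChoice) (y : nat * nat -> Sig) :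
  is_graph y <-> exists a, SigNN_eq y (graph_map a).
Proof.
  split.
  - intros Hy. destruct (countable_choice DC nat (fun n m => sprop (y (n, m))))
      as [a Ha]; [exact (fun n => proj1 (Hy n))|].
    exists a. intros [n m]. unfold Sig_eq, graph_map; cbn. split.
    + intros Hm. exact (proj2 (Hy n) m (a n) Hm (Ha n)).
    + intros ->. apply Ha.
  - intros [a Ha] n. split.
    + exists (a n). now apply (Ha (n, a n)).
    + intros m m' Hm Hm'. apply (Ha (n, m)) in Hm. apply (Ha (n, m')) in Hm'.
      cbn in Hm, Hm'. congruence.
Qed.

Lemma graph_map_image_stable (DC : DependentChoice) (MP : MarkovPrinciple)
    (y : nat * nat -> Sig) :
  ~ ~ (exists a, SigNN_eq y (graph_map a)) -> exists a, SigNN_eq y (graph_map a).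
Proof.
  intros NNy. apply (is_graph_iff DC), (is_graph_stable DC MP).
  intros Hy. apply NNy. intros Hgraph. now apply Hy, (is_graph_iff DC).
Qed.

Lemma none_below_false (f : nat -> bool) (n : nat) :
  none_below f n = false -> exists k, k < n /\ f k = true.
Proof.
  unfold none_below. rewrite negb_false_iff. intros [k [Hk Hfk]]%existsb_exists.
  rewrite in_seq in Hk. exists k. split; [lia | easy].
Qed.

Definition least_true (f : nat -> bool) (p : nat) : Prop :=
  f p = true /\ forall q, q < p -> f q = false.

Lemma least_true_unique (f : nat -> bool) (p p' : nat) :
  least_true f p -> least_true f p' -> p = p'.
Proof.
  intros [Hp Hbelow] [Hp' Hbelow'].
  destruct (lt_eq_lt_dec p p') as [[Hlt | Heq] | Hgt]; [| easy |].
  - rewrite Hbelow' in Hp by easy. discriminate.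
  - rewrite Hbelow in Hp' by easy. discriminate.
Qed.

Lemma least_true_exists (f : nat -> bool) (k : nat) :
  f k = true -> exists p, p <= k /\ least_true f p.
Proof.
  intros Hk.
  destruct (dec_inh_nat_subset_has_unique_least_element (fun n => f n = true))
    as [p [[Hp Hmin] _]]; [intros n; destruct (f n); auto | eauto |].
  exists p. split; [now apply Hmin|]. split; [easy|].
  intros q Hq. destruct (f q) eqn:Hfq; [|easy]. specialize (Hmin q Hfq). lia.
Qed.

Lemma least_true_below_or_none (f : nat -> bool) (n : nat) :
  (exists p, p < n /\ least_true f p) \/ (forall k, k < n -> f k = false).
Proof.
  destruct (none_below f n) eqn:Hn.
  - right. now apply none_below_spec.
  - left. destruct (none_below_false f n Hn) as [k [Hk Hfk]].
    destruct (least_true_exists f k Hfk) as [p [Hpk Hp]].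
    exists p. split; [lia | easy].
Qed.

Lemma least_true_semidec (f : nat -> bool) (p : nat) : semidec (least_true f p).
Proof.
  apply (semidec_iff (f p = true /\ none_below f p = true)).
  - now rewrite none_below_spec.
  - apply semidec_and; apply semidec_bool.
Qed.

(* The partial function read off a semidecidable relation: [D m k] means that the
   value [m] is confirmed at stage [k], and the value is the one confirmed first
   when the pairs [(m, k)] are searched in Cantor order. *)
Definition first_value (D : nat -> nat -> bool) (m : nat) : Prop :=
  exists p, least_true (fun q => D (fst (of_nat q)) (snd (of_nat q))) p /\ fst (of_nat p) = m.

Lemma first_value_functional (D : nat -> nat -> bool) (m m' : nat) :
  first_value D m -> first_value D m' -> m = m'.
Proof.
  intros [p [Hp <-]] [p' [Hp' <-]]. now rewrite (least_true_unique _ _ _ Hp Hp').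
Qed.

Lemma first_value_of_unique (D : nat -> nat -> bool) (m k : nat) :
  D m k = true -> (forall m' k', D m' k' = true -> m' = m) -> first_value D m.
Proof.
  intros Hmk Hunique.
  destruct (least_true_exists (fun q => D (fst (of_nat q)) (snd (of_nat q))) (to_nat (m, k)))
    as [p [_ Hp]]; [now rewrite cancel_of_to|].
  exists p. split; [exact Hp|]. exact (Hunique _ _ (proj1 Hp)).
Qed.

Lemma first_value_semidec (DC : DependentChoice) (D : nat -> nat -> bool) (m : nat) :
  semidec (first_value D m).
Proof.
  apply (semidec_exists DC). intros p. apply semidec_and; [apply least_true_semidec|].
  apply (semidec_iff ((fst (of_nat p) =? m) = true)); [apply Nat.eqb_eq | apply semidec_bool].
Qed.

Lemma first_value_pigeonhole (D : nat -> nat -> nat -> bool) (N : nat) :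
  ~ (forall c, c <= N -> exists j, j < N /\ first_value (D j) (S c)).
Proof.
  intros Hcover.
  destruct (Permutation_pigeonhole_rel (fun v j => first_value (D j) v)
              (l1 := seq 1 (S N)) (l2 := seq 0 N))
    as [v [v' [l [Hperm [j [_ [Hv Hv']]]]]]].
  - apply Forall_forall. intros v Hv%in_seq.
    destruct (Hcover (pred v)) as [j [Hj Hjv]]; [lia|].
    apply Exists_exists. exists j. rewrite in_seq.
    replace (S (pred v)) with v in Hjv by lia. split; [lia | easy].
  - rewrite !length_seq. lia.
  - rewrite (first_value_functional _ _ _ Hv Hv') in Hperm.
    pose proof (Permutation_NoDup Hperm (seq_NoDup (S N) 1)) as Hdup.
    apply NoDup_cons_iff in Hdup as [Hnotin _]. apply Hnotin. now left.
Qed.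

Definition leading_value_predicted (E : nat -> nat -> nat -> bool) (b : nat -> nat) : Prop :=
  forall x, b x <> 0 -> (forall x', x' < x -> b x' = 0) ->
  exists j, j < x /\ first_value (fun m => E j (to_nat (x, m))) (b x).

Lemma leading_value_predicted_ext (E : nat -> nat -> nat -> bool) (b b' : nat -> nat) :
  baire_eq b b' -> leading_value_predicted E b -> leading_value_predicted E b'.
Proof.
  intros Hbb' Hb x Hx Hbelow. rewrite <- Hbb' in Hx |- *.
  apply Hb; [exact Hx|]. intros x' Hx'. rewrite Hbb'. auto.
Qed.

Lemma first_nonzero_iff (b : nat -> nat) (x : nat) :
  least_true (fun x => negb (b x =? 0)) x <-> b x <> 0 /\ forall x', x' < x -> b x' = 0.
Proof.
  unfold least_true. rewrite negb_true_iff, Nat.eqb_neq.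
  setoid_rewrite negb_false_iff. setoid_rewrite Nat.eqb_eq. reflexivity.
Qed.

Lemma leading_value_predicted_semidec (DC : DependentChoice) (E : nat -> nat -> nat -> bool)
    (HE : forall P : nat -> Sig, exists j, forall n, sprop (P n) <-> exists k, E j n k = true)
    (b : nat -> nat) :
  semidec (leading_value_predicted E b).
Proof.
  destruct (HE (fun q => graph_map b (of_nat q))) as [i Hi].
  assert (self : forall x, first_value (fun m => E i (to_nat (x, m))) (b x)).
  { intros x. destruct (proj1 (Hi (to_nat (x, b x)))) as [k Hk].
    { rewrite cancel_of_to. reflexivity. }
    apply (first_value_of_unique (fun m => E i (to_nat (x, m))) _ k Hk). intros m k' Hk'.
    assert (Hm : sprop (graph_map b (of_nat (to_nat (x, m))))) by (apply Hi; eauto).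
    now rewrite cancel_of_to in Hm. }
  destruct (least_true_below_or_none (fun x => negb (b x =? 0)) (S i))
    as [[x0 [Hx0 [Hnz Hbelow]%first_nonzero_iff]] | Hzero].
  - apply (semidec_iff (exists j, j < x0 /\ first_value (fun m => E j (to_nat (x0, m))) (b x0))).
    + split; [intros Hpred x Hx Hxbelow | intros Hpred; now apply Hpred].
      assert (Hx0x : x0 = x).
      { apply (least_true_unique (fun x => negb (b x =? 0)));
          apply first_nonzero_iff; split; assumption. }
      now subst x.
    + apply (semidec_exists DC). intros j. apply semidec_and; [|apply first_value_semidec, DC].
      apply (semidec_iff ((j <? x0) = true)); [apply Nat.ltb_lt | apply semidec_bool].
  - apply (semidec_iff (true = true)); [|apply semidec_bool].
    split; [intros _ x Hx Hxbelow | easy]. exists i. split; [|apply self].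
    destruct (Nat.lt_ge_cases i x) as [Hlt | Hge]; [easy|]. exfalso. apply Hx.
    specialize (Hzero x ltac:(lia)). apply negb_false_iff, Nat.eqb_eq in Hzero. exact Hzero.
Qed.

Lemma Sig_map_graph_continuous (DC : DependentChoice) (MP : MarkovPrinciple)
    (EA : EnumerabilityAxiom) (T : (nat * nat -> Sig) -> Sig)
    (T_ext : forall y y', SigNN_eq y y' -> Sig_eq (T y) (T y')) (a : nat -> nat) :
  sprop (T (graph_map a)) ->
  exists N, forall b, (forall x, x < N -> b x = a x) -> sprop (T (graph_map b)).
Proof.
  intros Ta. destruct (Sig_map_continuous DC MP EA _ T T_ext fst _ Ta) as [N HN].
  exists N. intros b Hb. refine (Sig_map_monotone DC MP EA _ T T_ext _ _ _ HN).
  intros [x m]. cbn. intros [Hm Hx%Nat.ltb_lt]. now rewrite Hb.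
Qed.

Lemma graph_map_not_intrinsic (DC : DependentChoice) (MP : MarkovPrinciple)
    (EA : EnumerabilityAxiom) :
  ~ intrinsic_inclusion baire_eq SigNN_eq graph_map.
Proof.
  intros [_ Hext]. destruct (semidecider_enumeration DC EA) as [E HE].
  destruct (Hext (fun b => mkSig _ (leading_value_predicted_semidec DC E HE b)))
    as [T [T_ext HT]].
  { intros b b' Hbb'. unfold Sig_eq; cbn.
    split; apply leading_value_predicted_ext; congruence. }
  assert (T0 : sprop (T (graph_map (fun _ => 0)))).
  { apply (HT (fun _ => 0)). intros x Hx. easy. }
  destruct (Sig_map_graph_continuous DC MP EA T T_ext _ T0) as [N HN].
  apply (first_value_pigeonhole (fun j m => E j (to_nat (N, m))) N). intros c _.
  set (spike := fun x => if x =? N then S c else 0).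
  assert (spike_below : forall x, x < N -> spike x = 0).
  { intros x Hx. unfold spike. now rewrite (proj2 (Nat.eqb_neq x N)) by lia. }
  assert (Tspike : sprop (T (graph_map spike))) by now apply HN.
  apply (HT spike) in Tspike. cbn in Tspike.
  assert (spike_N : spike N = S c) by (unfold spike; now rewrite Nat.eqb_refl).
  rewrite <- spike_N. apply Tspike; [now rewrite spike_N | exact spike_below].
Qed.

Theorem proposition4p4 :
  DependentChoice -> MarkovPrinciple -> EnumerabilityAxiom ->
  StableSubspaceAxiom ->
  weak_intrinsic_inclusion baire_eq SigNN_eq graph_map /\
  ~ intrinsic_inclusion baire_eq SigNN_eq graph_map.
Proof.
  intros DC MP EA SSA. split.
  - apply weak_intrinsic_inclusion_of_stable_image; [exact EA | exact SSA | |].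
    + exact graph_map_injective.
    + exact (graph_map_image_stable DC MP).
  - exact (graph_map_not_intrinsic DC MP EA).
Qed.
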